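(* Let $0\ne T\ne I_X$ in $\mathcal{B}(X)$ have non-zero left and right annihilators, and let $T=\begin{bmatrix}T_1&T_2\\ 0&0\end{bmatrix}$ in $X=\mathcal{K}\oplus\mathcal{L}$ be a local block representation of $T$ with $T_1\ne I_{\mathcal{K}}$ and $\mathcal{N}(T_1)\ne\{0\}$. (i) Suppose $\mathcal{R}(T_1)\subset\mathcal{R}(T_2)$ and $C\in\mathcal{B}(\mathcal{K},\mathcal{L})$ satisfies $T_1=T_2C$ and $\mathcal{N}(C)=\mathcal{N}(T_1)$. Let $V\in\mathcal{B}(\mathcal{L},\mathcal{K})$ with $\mathcal{R}(V)\subset\mathcal{N}(T_1)$. Then $T=E_1E_2$ is the product of the two idempotents $$E_1=\begin{bmatrix}I_{\mathcal{K}}&T_2-V\\ 0&0\end{bmatrix},\qquad E_2=\begin{bmatrix}VC&V\\ C&I_{\mathcal{L}}\end{bmatrix}.$$ Furthermore, there are uncountably many such $V$'s and therefore uncountably many factorizations corresponding to these $V$'s. (ii) If $T_1$ is an idempotent, then $T$ can be expressed as a product of two idempotents in uncountably many ways: $T=E_1E_2$ with $$E_1=\begin{bmatrix}I_{\mathcal{K}}&T_2-V\\ 0&0\end{bmatrix},\qquad E_2=\begin{bmatrix}T_1+VC&V\\ C&I_{\mathcal{L}}\end{bmatrix},$$ where $V\in\mathcal{B}(\mathcal{L},\mathcal{K})$ and $C\in\mathcal{B}(\mathcal{K},\mathcal{L})$ satisfy $\mathcal{R}(V)\subset\mathcal{N}(T_1)$, $\mathcal{R}(V)\cup\mathcal{R}(T_1)\subset\mathcal{N}(C)$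 and $\mathcal{R}(C)\subset\mathcal{N}(T_2)$.
   Context: $X$ is a complex Banach space; $\mathcal{B}(X_1,X_2)$ denotes the bounded linear maps $X_1\to X_2$, $\mathcal{B}(X)=\mathcal{B}(X,X)$; $\mathcal{R}(\cdot)$ and $\mathcal{N}(\cdot)$ denote range and null space. A non-zero left (right) annihilator of $T$ is a non-zero $A\in\mathcal{B}(X)$ with $AT=0$ ($TA=0$). ''$X=\mathcal{K}\oplus\mathcal{L}$, a topological sum'' means $\mathcal{K},\mathcal{L}$ are closed subspaces, both different from $\{0\}$ and $X$, with $\mathcal{K}\cap\mathcal{L}=\{0\}$, $\mathcal{K}+\mathcal{L}=X$ and bounded associated projections. Operators are written in block form $\begin{bmatrix}A_1&A_2\\ A_3&A_4\end{bmatrix}$ with $A(k+l)=(A_1k+A_2l)+(A_3k+A_4l)$ for $k\in\mathcal{K}$, $l\in\mathcal{L}$. A local block representation of $T$ is its block form $\begin{bmatrix}T_1&T_2\\ 0&0\end{bmatrix}$ with respect to a topological sum $X=\mathcal{K}\oplus\mathcal{L}$ such that $\mathcal{K}$ contains the closure of $\mathcal{R}(T)$. *)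

(* Defs.v *)
From HB Require Import structures.
From mathcomp Require Export all_boot all_order all_algebra.
From mathcomp Require Export all_classical all_reals topology normedtype.
From mathcomp Require Export complex.
Set Implicit Arguments.
Unset Strict Implicit.
Unset Printing Implicit Defensive.
Import Order.TTheory GRing.Theory Num.Theory.
Import numFieldNormedType.Exports.
Local Open Scope classical_set_scope.
Local Open Scope ring_scope.

HB.mixin Record isBoundedOp (K : numFieldType) (V W : normedModType K)
    (f : V -> W) := {
  op_bound : exists M : K, forall x, `|f x| <= M * `|x|
}.

#[short(type="boundedOp")]
HB.structure Definition BoundedOp (K : numFieldType) (V W : normedModType K) :=
  {f of @GRing.Linear K V W *:%R f & isBoundedOp K V W f}.

Notation "{ 'bop' V -> W }" := (boundedOp V%type W%type)
  (at level 0, V at level 98, W at level 99, format "{ 'bop'  V  ->  W }")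
  : type_scope.

Section BoundedOpLmodule.
Context (K : numFieldType) (V W : normedModType K).

Definition bop : {pred V -> W} :=
  mem [set f : V -> W |
       linear f /\ exists M : K, forall x, `|f x| <= M * `|x|].

Section Sub.
Context (f : V -> W) (fP : f \in bop).
Let f_lin : linear f. Proof. by case: (set_mem fP). Qed.
Let f_bnd : exists M : K, forall x, `|f x| <= M * `|x|.
Proof. by case: (set_mem fP). Qed.
#[local] HB.instance Definition _ := GRing.isLinear.Build K V W *:%R f f_lin.
#[local] HB.instance Definition _ := isBoundedOp.Build K V W f f_bnd.
Definition bop_Sub : {bop V -> W} := f.
End Sub.

Lemma bop_valP (f : {bop V -> W}) : (f : V -> W) \in bop.
Proof.
by apply/mem_set; split; [exact: linearP|exact: op_bound].
Qed.

Lemma bop_SubK (u : {bop V -> W}) : bop_Sub (bop_valP u) = u.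
Proof.
case: u (bop_valP _) => f [[p1] [p2] [p3]] fP; rewrite /bop_Sub/=.
by congr (BoundedOp.Pack (BoundedOp.Class _ _ _));
  set m := LHS; case: m => q; congr (_ _); exact: Prop_irrelevance.
Qed.

Lemma bop_rect (P : {bop V -> W} -> Type) :
  (forall f (fP : f \in bop), P (bop_Sub fP)) -> forall u, P u.
Proof. by move=> Psub u; rewrite -[u]bop_SubK. Qed.

Lemma bop_SubE f (fP : f \in bop) : bop_Sub fP = f :> (V -> W).
Proof. by []. Qed.

HB.instance Definition _ :=
  isSub.Build (V -> W) _ {bop V -> W} bop_rect bop_SubE.

HB.instance Definition _ := [Choice of {bop V -> W} by <:].

Lemma bopP (f g : {bop V -> W}) : f = g <-> f =1 g.
Proof. by split=> [->//|fg]; exact/val_inj/funext. Qed.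

Lemma bop_submod_closed : submod_closed bop.
Proof.
split=> [|a f g /set_mem[fl [M fM]] /set_mem[gl [N gN]]]; apply/mem_set.
  split=> [a u v|]; first by rewrite /= scaler0 addr0.
  by exists 0 => x; rewrite /= normr0 mul0r.
split=> [b u v|].
  rewrite !addrfctE !scalrfctE fl gl !scalerDr !scalerA (mulrC a).
  by rewrite addrACA.
exists (`|a| * M + N) => x; rewrite addrfctE scalrfctE.
by rewrite (le_trans (ler_normD _ _))// mulrDl lerD// normrZ -mulrA ler_wpM2l.
Qed.

HB.instance Definition _ :=
  GRing.isSubmodClosed.Build K (V -> W) bop bop_submod_closed.

HB.instance Definition _ := [SubChoice_isSubLmodule of {bop V -> W} by <:].

End BoundedOpLmodule.

Section BoundedOpComp.
Context (K : numFieldType) (U V W : normedModType K).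

Let id_bound : exists M : K, forall x, `|@idfun U x| <= M * `|x|.
Proof. by exists 1 => x; rewrite mul1r. Qed.
HB.instance Definition _ := isBoundedOp.Build K U U idfun id_bound.

Let comp_bound (g : {bop V -> W}) (f : {bop U -> V}) :
  exists M : K, forall x, `|(g \o f) x| <= M * `|x|.
Proof.
have [M gM] := op_bound (s := g); have [N fN] := op_bound (s := f).
exists (`|M| * N) => x /=; rewrite (le_trans (gM _))//.
rewrite -mulrA (@le_trans _ _ (`|M| * `|f x|)) ?ler_wpM2l//.
case: (eqVneq (f x) 0) => [->|fx0]; first by rewrite !normr0 !mulr0.
rewrite ler_wpM2r// ger0_norm// -(pmulr_lge0 _ (_ : 0 < `|f x|)) ?normr_gt0//.
by rewrite (le_trans _ (gM _)).
Qed.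
HB.instance Definition _ (g : {bop V -> W}) (f : {bop U -> V}) :=
  isBoundedOp.Build K U W (g \o f) (comp_bound g f).
End BoundedOpComp.

Definition id_op (K : numFieldType) (V : normedModType K) : {bop V -> V} :=
  idfun.
Arguments id_op {K} V.

Definition comp_op (K : numFieldType) (U V W : normedModType K)
  (g : {bop V -> W}) (f : {bop U -> V}) : {bop U -> W} := g \o f.
Notation "g \o_b f" := (comp_op g f) (at level 40, left associativity)
  : ring_scope.

Definition null_space (K : numFieldType) (V W : normedModType K)
  (f : {bop V -> W}) : set V := [set x | f x = 0].

Definition bop_idempotent (K : numFieldType) (V : normedModType K)
  (f : {bop V -> V}) : Prop := f \o_b f = f.

Definition has_left_annihilator (K : numFieldType) (V : normedModType K)
  (f : {bop V -> V}) : Prop := exists A : {bop V -> V}, A <> 0 /\ A \o_b f = 0.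

Definition has_right_annihilator (K : numFieldType) (V : normedModType K)
  (f : {bop V -> V}) : Prop := exists A : {bop V -> V}, A <> 0 /\ f \o_b A = 0.

Record closedSubspace (K : numFieldType) (X : normedModType K) := {
  csub_set : set X ;
  csub_submod : submod_closed (mem csub_set : {pred X}) ;
  csub_closed : closed csub_set
}.

Section ClosedSubspaceNormed.
Context (K : numFieldType) (X : normedModType K) (S : closedSubspace X).

Definition csub_pred : {pred X} := mem (csub_set S).

HB.instance Definition _ :=
  GRing.isSubmodClosed.Build K X csub_pred (csub_submod S).

(* S as a normed space of its own, with the norm inherited from X *)
Record csub := Csub { csub_val : X ; csub_valP : csub_val \in csub_pred }.

HB.instance Definition _ := [isSub for csub_val].
HB.instance Definition _ := [Choice of csub by <:].
HB.instance Definition _ := [SubChoice_isSubLmodule of csub by <:].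

Let csub_norm (x : csub) : K := `|csub_val x|.

Let ler_csub_normD x y : csub_norm (x + y) <= csub_norm x + csub_norm y.
Proof. exact: ler_normD. Qed.

Let csub_normZ (l : K) x : csub_norm (l *: x) = `|l| * csub_norm x.
Proof. exact: normrZ. Qed.

Let csub_norm0_eq0 x : csub_norm x = 0 -> x = 0.
Proof. by move/normr0_eq0 => x0; exact/val_inj. Qed.

HB.instance Definition _ := Lmodule_isNormed.Build K csub
  ler_csub_normD csub_normZ csub_norm0_eq0.

Let incl_linear : linear csub_val.
Proof. by []. Qed.

Let incl_bound : exists M : K, forall x : csub, `|csub_val x| <= M * `|x|.
Proof. by exists 1 => x; rewrite mul1r. Qed.

HB.instance Definition _ := GRing.isLinear.Build K csub X *:%R csub_val
  incl_linear.
HB.instance Definition _ := isBoundedOp.Build K csub X csub_val incl_bound.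

Definition incl_op : {bop csub -> X} := csub_val.

End ClosedSubspaceNormed.
Coercion csub : closedSubspace >-> Sortclass.

Section TopologicalSum.
Context (F : numFieldType) (X : normedModType F).

(* The projections are determined by the equations tsum_proj1E and
   tsum_proj2E, so carrying them as data adds only their boundedness. *)
Record topologicalSum (K L : closedSubspace X) := {
  tsum_neq01 : csub_set K <> [set 0] ;
  tsum_neqT1 : csub_set K <> setT ;
  tsum_neq02 : csub_set L <> [set 0] ;
  tsum_neqT2 : csub_set L <> setT ;
  tsum_cap : csub_set K `&` csub_set L = [set 0] ;
  tsum_add : [set k + l | k in csub_set K & l in csub_set L] = setT ;
  tsum_proj1 : {bop X -> K} ;
  tsum_proj2 : {bop X -> L} ;
  tsum_proj1E : forall (k : K) (l : L),
    tsum_proj1 (csub_val k + csub_val l) = k ;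
  tsum_proj2E : forall (k : K) (l : L),
    tsum_proj2 (csub_val k + csub_val l) = l
}.

Context (K L : closedSubspace X) (D : topologicalSum K L).

Definition block_op (A1 : {bop K -> K}) (A2 : {bop L -> K})
    (A3 : {bop K -> L}) (A4 : {bop L -> L}) : {bop X -> X} :=
  incl_op K \o_b (A1 \o_b tsum_proj1 D + A2 \o_b tsum_proj2 D)
  + incl_op L \o_b (A3 \o_b tsum_proj1 D + A4 \o_b tsum_proj2 D).

Lemma block_opE A1 A2 A3 A4 (k : K) (l : L) :
  block_op A1 A2 A3 A4 (csub_val k + csub_val l) =
  csub_val (A1 k + A2 l) + csub_val (A3 k + A4 l).
Proof.
set x := _ + _; rewrite -[LHS]/(
    csub_val (A1 (tsum_proj1 D x) + A2 (tsum_proj2 D x)) +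
    csub_val (A3 (tsum_proj1 D x) + A4 (tsum_proj2 D x))).
by rewrite tsum_proj1E tsum_proj2E.
Qed.

Definition local_block_rep (T : {bop X -> X})
    (T1 : {bop K -> K}) (T2 : {bop L -> K}) : Prop :=
  T = block_op T1 T2 0 0 /\ closure (range T) `<=` csub_set K.

End TopologicalSum.

(* Main.v *)
Require Import Defs.
From mathcomp Require Import all_boot all_order all_algebra.
From mathcomp Require Import all_classical all_reals topology normedtype.
From mathcomp Require Import complex.
From HB Require Import structures.
From mathcomp Require Import lra ring lebesgue_measure.
Set Implicit Arguments.
Unset Strict Implicit.
Unset Printing Implicit Defensive.
Import Order.TTheory GRing.Theory Num.Theory.
Import numFieldNormedType.Exports.
Local Open Scope classical_set_scope.
Local Open Scope ring_scope.

(* Both factorizations are block computations.  The uncountability of the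
   families needs one non-zero bounded operator from L into the null space of
   T1: it is of the form l |-> f(l) k0 with T1 k0 = 0, where f is a non-zero
   bounded functional provided by the Hahn-Banach theorem.  Its real multiples
   V_t are pairwise distinct and admissible, and V is the upper right block of
   E2, so distinct V's give distinct pairs (E1, E2). *)

(** * The Hahn-Banach theorem for a sublinear functional on a real vector space *)

Section RealHahnBanach.
Context (R : realType) (V : lmodType R) (p : V -> R).
Hypothesis p_subadd : forall x y, p (x + y) <= p x + p y.
Hypothesis p_homog : forall t x, 0 < t -> p (t *: x) = t * p x.

(* A partial linear functional is represented by its graph.  Domination by [p]
   already forces a graph closed under linear combinations to be functional:
   if [(0, a)] lies in it, then [t * a <= p 0 = 0] for every [t]. *)
Definition dominated_graph (A : set (V * R)) : Prop :=
  (forall t x a y b, A (x, a) -> A (y, b) -> A (t *: x + y, t * a + b)) /\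
  (forall x a, A (x, a) -> a <= p x).

(** Homogeneity with t = 2 gives p 0 = 2 p 0. *)
Lemma sublinear0 : p 0 = 0.
Proof.
by have := p_homog 0 (ltr0Sn R 1); rewrite scaler0 => h; lra.
Qed.

Lemma dominated_graph_line x0 :
  dominated_graph [set (t *: x0, t * p x0) | t in setT].
Proof.
split=> [t x a y b|x a] /=.
  move=> [r _ [<- <-]] [s _ [<- <-]]; exists (t * r + s) => //.
  by rewrite scalerDl scalerA mulrDl mulrA.
move=> [t _ [<- <-]]; case: (ltrgt0P t) => [t0|t0|->].
- by rewrite p_homog.
(* For t < 0, subadditivity gives 0 = p 0 <= p (t x0) - t p x0. *)
- have := p_subadd (t *: x0) ((- t) *: x0).
  rewrite -scalerDl subrr scale0r sublinear0 (@p_homog (- t)) ?oppr_gt0// => h.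
  by lra.
- by rewrite mul0r scale0r sublinear0.
Qed.

Lemma dominated_graph0 A : dominated_graph A -> A !=set0 -> A (0, 0).
Proof.
move=> [Alin _] [[x a] Axa]; have := Alin (-1) _ _ _ _ Axa Axa.
by rewrite scaleN1r mulN1r !addNr.
Qed.

Lemma dominated_graph_functional A x a b : dominated_graph A ->
  A (x, a) -> A (x, b) -> a = b.
Proof.
move=> [Alin Adom] Aa Ab.
have le_sub c d : A (x, c) -> A (x, d) -> c <= d.
  move=> Ac Ad; have /Adom := Alin (-1) _ _ _ _ Ad Ac.
  by rewrite scaleN1r addNr sublinear0 => h; lra.
by apply/eqP; rewrite eq_le !le_sub.
Qed.

(** A value c at z keeps domination as soon as a - p (x - z) <= c <= p (y + z) - b for all points
    (x, a), (y, b) of the graph. Subadditivity puts every lower bound below every upper one, so the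
    supremum of the lower bounds serves as c. No case distinction on whether z is already in the
    domain is made. *)
Lemma dominated_graph_extend A z : dominated_graph A -> A !=set0 ->
  exists B, [/\ dominated_graph B, A `<=` B & exists c, B (z, c)].
Proof.
move=> domA An0; have [Alin Adom] := domA.
have A00 := dominated_graph0 domA An0.
pose W := [set w.2 - p (w.1 - z) | w in A].
have Wub x a y b : A (x, a) -> A (y, b) -> a - p (x - z) <= p (y + z) - b.
  move=> Axa Ayb; have /Adom := Alin 1 _ _ _ _ Axa Ayb.
  rewrite scale1r mul1r; have := p_subadd (x - z) (y + z).
  by rewrite addrACA addNr addr0 => h1 h2; lra.
have W0 : W !=set0 by exists (0 - p (0 - z)), (0, 0).
have supW : has_sup W.
  by split=> //; exists (p (0 + z) - 0) => _ [[x a] Axa <-]; exact: Wub A00.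
pose c := sup W.
have cl x a : A (x, a) -> a - c <= p (x - z).
  move=> Axa; have : a - p (x - z) <= c.
    by apply: sup_upper_bound => //; exists (x, a).
  by move=> h; lra.
have cr x a : A (x, a) -> a + c <= p (x + z).
  move=> Axa; have : c <= p (x + z) - a.
    by apply: ge_sup => // _ [[y b] Ayb <-]; exact: Wub.
  by move=> h; lra.
have Ascale t x a : A (x, a) -> A (t *: x, t * a).
  by move=> Axa; have := Alin t _ _ _ _ Axa A00; rewrite !addr0.
exists [set w | exists x a t, A (x, a) /\ w = (x + t *: z, a + t * c)]; split.
- split=> [t ? ? ? ?|? ?].
    move=> [x [a [r [Axa [-> ->]]]]] [y [b [s [Ayb [-> ->]]]]].
    exists (t *: x + y), (t * a + b), (t * r + s); split; first exact: Alin.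
    rewrite scalerDr scalerDl scalerA addrACA; congr (_, _); ring.
  (* Dividing by |t| reduces domination at x + t z to [cr] for t > 0 and to [cl] for t < 0. *)
  move=> [x [a [t [Axa [-> ->]]]]]; case: (ltrgt0P t) => [t0|t0|->].
  + have /cr := Ascale t^-1 _ _ Axa.
    rewrite -(ler_pM2l t0) -p_homog// scalerDr scalerA mulrDr mulrA.
    by rewrite divff ?gt_eqF// scale1r mul1r.
  + have t0' : 0 < - t by rewrite oppr_gt0.
    have /cl := Ascale (- t)^-1 _ _ Axa.
    rewrite -(ler_pM2l t0') -p_homog// scalerBr scalerA mulrBr mulrA.
    by rewrite divff ?gt_eqF// scale1r mul1r scaleNr mulNr !opprK.
  + by rewrite mul0r scale0r !addr0; exact: Adom.
- move=> [x a] Axa; exists x, a, 0.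
  by rewrite scale0r mul0r !addr0.
- by exists c, 0, 0, 1; rewrite scale1r mul1r !add0r.
Qed.

(** Zorn's lemma gives a maximal dominated graph containing the line through (x0, p x0); one-step
    extension shows that it is defined everywhere. *)
Theorem hahn_banach_sublinear x0 :
  exists u : {linear V -> R^o}, (forall x, u x <= p x) /\ u x0 = p x0.
Proof.
pose line := [set (t *: x0, t * p x0) | t in setT].
(* The union of the empty chain is empty, hence the guard on [line `<=` A]. *)
pose P A := (A !=set0 -> line `<=` A) /\ dominated_graph A.
have [|A [[lineA domA] Amax]] := @Zorn_bigcup _ P.
  move=> F FP Ftot; split.
    move=> [w [A FA Aw]] v /(FP _ FA).1 Av; exists A => //.
    by apply: Av; exists w.
  split=> [t x a y b [A FA Aa] [B FB Bb]|x a [A FA Aa]]; last first.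
    exact: (FP _ FA).2.2.
  (* Two points of the union of a chain lie in a common member. *)
  have [AB|BA] := Ftot _ _ FA FB.
    by exists B => //; apply: (FP _ FB).2.1 => //; exact: AB.
  by exists A => //; apply: (FP _ FA).2.1 => //; exact: BA.
have line0 : line (x0, p x0) by exists 1 => //; rewrite scale1r mul1r.
have An0 : A !=set0.
  (* The line itself would properly extend an empty maximal graph. *)
  apply/set0P/eqP => A0; apply: (Amax line); last first.
    by split=> [_ //|]; exact: dominated_graph_line.
  by rewrite A0; split=> // /(_ _ line0).
have total z : exists c, A (z, c).
  have [B [domB AB [c Bzc]]] := dominated_graph_extend z domA An0.
  exists c; apply: contrapT => nA; apply: (Amax B).
    by split=> // /(_ _ Bzc).
  by split=> // _; apply: subset_trans AB; exact: lineA.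
pose u z := projT1 (cid (total z)).
have Au z : A (z, u z) by rewrite /u; case: cid.
have ulin : linear (u : V -> R^o).
  (* Both sides are values of the same graph at t x + y, hence equal. *)
  move=> t x y; apply: (dominated_graph_functional domA (Au _)).
  by apply: domA.1; exact: Au.
exists (HB.pack_for {linear V -> R^o} u (GRing.isLinear.Build _ _ _ _ u ulin)).
split=> [x|] /=; first exact: domA.2.
by apply: (dominated_graph_functional domA (Au _)); exact: lineA.
Qed.

End RealHahnBanach.

(** * Restriction to real scalars and bounded functionals on complex normed spaces *)

Section RestrictScalars.
Context (R : realType) (V : lmodType R[i]).

(** A separate name for [V], to carry the real scalar action beside the complex one. *)
Definition realified : Type := V.
HB.instance Definition _ := GRing.Zmodule.on realified.

Let rscale (t : R) (x : realified) : realified := t%:C%C *: (x : V).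
Let rscaleA s t x : rscale s (rscale t x) = rscale (s * t) x.
Proof. by rewrite /rscale scalerA -rmorphM. Qed.
Let rscale1 : left_id 1 rscale.
Proof. by move=> x; rewrite /rscale scale1r. Qed.
Let rscaleDr : right_distributive rscale +%R.
Proof. by move=> t x y; rewrite /rscale scalerDr. Qed.
Let rscaleDl x : {morph rscale^~ x : s t / s + t}.
Proof. by move=> s t; rewrite /rscale rmorphD scalerDl. Qed.
HB.instance Definition _ := GRing.Zmodule_isLmodule.Build R realified
  rscaleA rscale1 rscaleDr rscaleDl.

Lemma realified_scaleE (t : R) (x : V) :
  t *: (x : realified) = t%:C%C *: x :> V.
Proof. by []. Qed.

End RestrictScalars.

(** Norms take values in [R[i]]; being non-negative they are real, so they can be compared with
    [R]-valued functionals. *)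
Lemma normc_Re (R : realType) (V : normedModType R[i]) (x : V) :
  `|x| = (complex.Re `|x|)%:C%C.
Proof. by rewrite RRe_real// ger0_real. Qed.

(* The real Hahn-Banach functional [u] is the real part of the complex one,
   [x |-> u x - i u (i x)]. *)
Theorem exists_bounded_functional (R : realType) (V : normedModType R[i])
    (x0 : V) : x0 != 0 -> exists f : {bop V -> R[i]^o}, f x0 != 0.
Proof.
move=> x0n0; pose p (x : realified V) : R := complex.Re `|x : V|.
have psub x y : p (x + y) <= p x + p y.
  by rewrite -lecR rmorphD /= /p -!normc_Re ler_normD.
have phom t x : 0 < t -> p (t *: x) = t * p x.
  move=> t0; apply: (@complexI R); rewrite rmorphM /= /p -!normc_Re.
  by rewrite realified_scaleE normrZ ger0_norm// ler0c ltW.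
have [u [uD uZ up ux0]] : exists u : V -> R, [/\ {morph u : x y / x + y},
    forall t x, u (t%:C%C *: x) = t * u x, forall x, u x <= p x & u x0 = p x0].
  have [u [up ux0]] := hahn_banach_sublinear psub phom (x0 : realified V).
  by exists u; split=> //; [exact: (linearD u)|exact: (linearZ_LR u)].
have u_abs x : `|u x| <= p x.
  (* The lower bound is - u x = u (- x) <= p (- x) = p x. *)
  rewrite ler_norml up andbT lerNl -mulN1r -uZ rmorphN rmorph1 scaleN1r.
  by rewrite (le_trans (up _))// /p normrN.
pose f (x : V) : R[i]^o := (u x +i* - u ('i%C *: x))%C.
have uC (a b : R) z : u ((a +i* b)%C *: z) = a * u z + b * u ('i%C *: z).
  rewrite [(_ +i* _)%C]complexE scalerDl /= [_ * _%:C%C]mulrC.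
  by rewrite -scalerA uD !uZ.
have flin : linear f.
  move=> [a b] x y; rewrite /f scalerDr scalerA.
  have -> : ('i * (a +i* b) = - b +i* a)%C.
    by apply/eqP; rewrite eq_complex /=; apply/andP; split; apply/eqP; ring.
  rewrite !uD (uC a b) (uC (- b) a).
  by apply/eqP; rewrite eq_complex /=; apply/andP; split; apply/eqP; ring.
have fbnd : exists M : R[i], forall x : V, `|f x| <= M * `|x|.
  (* The constant 2 arises because |u x| and |u (i x)| are both at most the norm of x. *)
  exists 2 => x; have -> : f x = (u x)%:C%C - 'i%C * (u ('i%C *: x))%:C%C.
    by apply/eqP; rewrite eq_complex /=; apply/andP; split; apply/eqP; ring.
  have normcR (t : R) : `|t%:C%C : R[i]| = `|t|%:C%C.
    by rewrite normc_def /= expr0n addr0 sqrtr_sqr.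
  have normci : `|'i%C : R[i]| = 1.
    by rewrite normc_def /= expr0n expr1n add0r sqrtr1.
  rewrite (le_trans (ler_normB _ _))// mulr2n mulrDl mul1r lerD//.
    by rewrite normcR normc_Re lecR; exact: u_abs.
  have -> : `|x| = `|'i%C *: x| by rewrite normrZ normci mul1r.
  by rewrite normrM normci mul1r normcR normc_Re lecR; exact: u_abs.
exists (bop_Sub (mem_set (conj flin fbnd))).
(* The real part of f x0 is p x0, the norm of x0. *)
apply/eqP => /(congr1 (@complex.Re R)) /=; rewrite ux0 => px0.
by move: x0n0; rewrite -normr_eq0 normc_Re [complex.Re _]px0 eqxx.
Qed.

(** Through the injection, countability of [S] would pass to [0, 1]; but countable sets have
    Lebesgue measure 0 and [0, 1] has measure 1. *)
Lemma uncountable_family (R : realType) (Z : Type) (S : set Z) (g : R -> Z) :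
  injective g -> (forall t, S (g t)) -> ~ countable S.
Proof.
move=> ginj gS cS.
have /countable_lebesgue_measure0 : countable `[0%R, 1%R : R]%classic.
  apply: (@sub_countable _ _ _ S) => //; apply: card_le_trans (subset_card_le _).
    by rewrite -(card_le_eql (inj_card_eq (f := g) _)); last exact: in2W.
  by move=> _ [t _ <-]; exact: gS.
by rewrite lebesgue_measure_itv /= lte_fin ltr01 -EFinB subr0 => /eqP;
  rewrite eqe oner_eq0.
Qed.

(** * Pointwise evaluation, rank-one operators and non-zero vectors *)

Section BoundedOpEval.
Context (F : numFieldType) (U V W : normedModType F).

Lemma bop_addE (A B : {bop U -> W}) x : (A + B) x = A x + B x.
Proof. by []. Qed.

Lemma bop_oppE (A : {bop U -> W}) x : (- A) x = - A x.
Proof. by []. Qed.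

Lemma bop_0E x : (0 : {bop U -> W}) x = 0.
Proof. by []. Qed.

Lemma bop_scaleE a (A : {bop U -> W}) x : (a *: A) x = a *: A x.
Proof. by []. Qed.

Lemma comp_opE (g : {bop V -> W}) (f : {bop U -> V}) x : (g \o_b f) x = g (f x).
Proof. by []. Qed.

Lemma id_opE x : id_op U x = x.
Proof. by []. Qed.

Lemma bopD (A : {bop U -> W}) x y : A (x + y) = A x + A y.
Proof. exact: linearD. Qed.

Lemma bopZ (A : {bop U -> W}) a x : A (a *: x) = a *: A x.
Proof. exact: linearZ_LR. Qed.

Lemma bop0 (A : {bop U -> W}) : A 0 = 0.
Proof. exact: linear0. Qed.

End BoundedOpEval.

Definition bopE := (bop_addE, bop_oppE, bop_0E, bop_scaleE, comp_opE, id_opE).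

(** For a bounded functional f with f u0 non-zero, the operator u |-> (f u / f u0) w0 has both
    properties. *)
Lemma exists_rank_one (R : realType) (U W : normedModType R[i]) (u0 : U)
    (w0 : W) :
  u0 != 0 -> exists V : {bop U -> W},
    V u0 = w0 /\ forall u, exists c, V u = c *: w0.
Proof.
move=> /exists_bounded_functional[f fu0].
pose g u : W := ((f u0)^-1 * f u) *: w0.
have glin : linear g.
  move=> a x y; rewrite /g linearD linearZ/= mulrDr scalerDl scalerA.
  by rewrite -[a *: f x]/(a * f x) mulrCA.
have gbnd : exists M : R[i], forall u, `|g u| <= M * `|u|.
  have [M fM] := op_bound (s := f); exists (`|(f u0)^-1| * `|w0| * M) => u.
  by rewrite normrZ normrM mulrAC -[leRHS]mulrA ler_wpM2l// mulr_ge0.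
exists (bop_Sub (mem_set (conj glin gbnd))); rewrite bop_SubE; split.
  by rewrite /g mulVf// scale1r.
by move=> u; eexists.
Qed.

Lemma csub_neq0 (F : numFieldType) (X : normedModType F)
    (S : closedSubspace X) :
  csub_set S <> [set 0] -> exists x : S, x != 0.
Proof.
move=> S0; apply: contrapT => /forallNP nS; apply: S0; apply/seteqP; split.
  move=> x Sx; have /negP := nS (Csub (mem_set Sx)).
  by rewrite negbK => /eqP/(congr1 (@csub_val _ _ _)).
by move=> _ ->; exact: set_mem (csub_valP (0 : S)).
Qed.

Lemma null_space_neq0 (F : numFieldType) (U W : normedModType F)
    (A : {bop U -> W}) :
  null_space A <> [set 0] -> exists2 x, A x = 0 & x != 0.
Proof.
move=> A0; apply: contrapT => nA; apply: A0; apply/seteqP; split.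
  move=> x Ax; apply: contrapT => /eqP x0; by apply: nA; exists x.
by move=> _ ->; exact: linear0.
Qed.

(** * Block calculus in a topological sum *)

Section BlockOperators.
Context (F : numFieldType) (X : normedModType F) (K L : closedSubspace X).
Context (D : topologicalSum K L).

(** [block_opE] evaluates block operators on sums k + l, and these exhaust X. *)
Lemma tsum_ext (Y : normedModType F) (A B : {bop X -> Y}) :
  (forall (k : K) (l : L),
    A (csub_val k + csub_val l) = B (csub_val k + csub_val l)) -> A = B.
Proof.
move=> AB; apply/bopP => x.
have [k Kk [l Ll <-]] : [set k + l | k in csub_set K & l in csub_set L] x.
  by rewrite (tsum_add D).
exact: (AB (Csub (mem_set Kk)) (Csub (mem_set Ll))).
Qed.

Lemma block_op_comp A1 A2 A3 A4 B1 B2 B3 B4 :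
  block_op D A1 A2 A3 A4 \o_b block_op D B1 B2 B3 B4 =
  block_op D (A1 \o_b B1 + A2 \o_b B3) (A1 \o_b B2 + A2 \o_b B4)
             (A3 \o_b B1 + A4 \o_b B3) (A3 \o_b B2 + A4 \o_b B4).
Proof.
apply: tsum_ext => k l; rewrite comp_opE !block_opE !bop_addE !comp_opE.
by rewrite !linearD; congr (_ + _); rewrite addrACA.
Qed.

(** Applying the operator to 0 + l and projecting to K recovers the upper right block. *)
Lemma block_op_inj2 A1 A2 A3 A4 B1 B2 B3 B4 :
  block_op D A1 A2 A3 A4 = block_op D B1 B2 B3 B4 -> A2 = B2.
Proof.
move=> AB; apply/bopP => l.
have := congr1 (fun A : {bop X -> X} =>
  tsum_proj1 D (A (csub_val (0 : K) + csub_val l))) AB.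
by rewrite !block_opE !tsum_proj1E !linear0 !add0r.
Qed.

Lemma block_op_ext
  (A1 B1 : {bop K -> K}) (A2 B2 : {bop L -> K})
  (A3 B3 : {bop K -> L}) (A4 B4 : {bop L -> L}) :
  A1 =1 B1 -> A2 =1 B2 -> A3 =1 B3 -> A4 =1 B4 ->
  block_op D A1 A2 A3 A4 = block_op D B1 B2 B3 B4.
Proof. by move=> /bopP -> /bopP -> /bopP -> /bopP ->. Qed.

Lemma block_op_proj1_idem A :
  bop_idempotent (block_op D (id_op K) A 0 0).
Proof.
rewrite /bop_idempotent block_op_comp.
by apply: block_op_ext => x; rewrite !bopE ?bop0 ?addr0.
Qed.

(* Both factorizations are instances: [S = 0] in (i) and [S = T1] in (ii). *)
Lemma block_op_factorization (S T1 : {bop K -> K})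
  (T2 V : {bop L -> K}) (C : {bop K -> L}) :
  bop_idempotent S -> S \o_b V = 0 -> C \o_b S = 0 -> C \o_b V = 0 ->
  T1 = S + T2 \o_b C ->
  [/\ bop_idempotent (block_op D (id_op K) (T2 - V) 0 0),
      bop_idempotent (block_op D (S + V \o_b C) V C (id_op L)) &
      block_op D T1 T2 0 0 = block_op D (id_op K) (T2 - V) 0 0
        \o_b block_op D (S + V \o_b C) V C (id_op L)].
Proof.
move=> /bopP SS /bopP SV /bopP CS /bopP CV T1E.
have {}SS x : S (S x) = S x by exact: SS.
have {}SV x : S (V x) = 0 by exact: SV.
have {}CS x : C (S x) = 0 by exact: CS.
have {}CV x : C (V x) = 0 by exact: CV.
split.
- exact: block_op_proj1_idem.
- rewrite /bop_idempotent block_op_comp; apply: block_op_ext => x.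
  (* The four relations reduce (S + VC)^2 to S; the term VC comes from the product of the
     off-diagonal blocks. *)
  + by rewrite !bopE bopD SS SV bopD CS CV !addr0 bop0 addr0.
  + by rewrite !bopE SV CV bop0 !add0r.
  + by rewrite !bopE bopD CS CV !add0r.
  + by rewrite !bopE CV add0r.
- rewrite block_op_comp; apply: block_op_ext => x; rewrite ?T1E !bopE.
  (* [V] cancels: S + VC + (T2 - V)C = S + T2 C. *)
  + by rewrite -addrA [V _ + _]addrC subrK.
  + by rewrite addrC subrK.
  + by rewrite !addr0.
  + by rewrite !addr0.
Qed.

End BlockOperators.

(** * Both families of factorizations and their uncountability *)

Theorem theorem4p8 (R : realType) (X : completeNormedModType R[i])
  (T : {bop X -> X}) (T_neq0 : T <> 0) (T_neq1 : T <> id_op X)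
  (T_lann : has_left_annihilator T) (T_rann : has_right_annihilator T)
  (K L : closedSubspace X) (D : topologicalSum K L)
  (T1 : {bop K -> K}) (T2 : {bop L -> K})
  (T_rep : local_block_rep D T T1 T2)
  (T1_neq1 : T1 <> id_op K) (T1_ker : null_space T1 <> [set 0]) :
  (range T1 `<=` range T2 ->
   forall C : {bop K -> L}, T1 = T2 \o_b C -> null_space C = null_space T1 ->
   let E1 (V : {bop L -> K}) := block_op D (id_op K) (T2 - V) 0 0 in
   let E2 (V : {bop L -> K}) := block_op D (V \o_b C) V C (id_op L) in
   let admissible := [set V : {bop L -> K} | range V `<=` null_space T1] in
   [/\ forall V, admissible V ->
         [/\ bop_idempotent (E1 V), bop_idempotent (E2 V) &
             T = E1 V \o_b E2 V],
       ~ countable admissible &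
       ~ countable [set (E1 V, E2 V) | V in admissible]])
  /\
  (bop_idempotent T1 ->
   let E1 (V : {bop L -> K}) := block_op D (id_op K) (T2 - V) 0 0 in
   let E2 (V : {bop L -> K}) (C : {bop K -> L}) :=
     block_op D (T1 + V \o_b C) V C (id_op L) in
   let admissible := [set VC : {bop L -> K} * {bop K -> L} |
     [/\ range VC.1 `<=` null_space T1,
         range VC.1 `|` range T1 `<=` null_space VC.2 &
         range VC.2 `<=` null_space T2]] in
   (forall V C, admissible (V, C) ->
      [/\ bop_idempotent (E1 V), bop_idempotent (E2 V C) &
          T = E1 V \o_b E2 V C])
   /\ ~ countable [set (E1 VC.1, E2 VC.1 VC.2) | VC in admissible]).
Proof.
have [k0 T1k0 k0n0] := null_space_neq0 T1_ker.
have [l0 l0n0] := csub_neq0 (tsum_neq02 D).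
have [V0 [V0l0 V0k0]] := exists_rank_one k0 l0n0.
pose V (t : R) := t%:C%C *: V0.
have V_ker t : range (V t) `<=` null_space T1.
  move=> _ [l _ <-]; have [c Vl] := V0k0 l.
  by rewrite bop_scaleE Vl /null_space /= !bopZ T1k0 !scaler0.
have V_inj : injective V.
  (* Evaluation at [l0] gives s k0 = t k0 with k0 non-zero. *)
  move=> s t /bopP/(_ l0); rewrite /V !bopE V0l0 => /eqP.
  rewrite -subr_eq0 -scalerBl scaler_eq0 (negPf k0n0) orbF subr_eq0.
  by move=> /eqP/complexI.
split.
- move=> _ C T1E NC E1 E2 admissible.
  have uncountable_pairs : ~ countable [set (E1 W, E2 W) | W in admissible].
    apply: (@uncountable_family R _ _ (fun t => (E1 (V t), E2 (V t)))).
      by move=> s t /(congr1 snd) /= /block_op_inj2/V_inj.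
    by move=> t; exists (V t) => //; exact: V_ker.
  split=> //.
    move=> W Wker; rewrite T_rep.1 /E2.
    (* The range of [W] lies in N(T1), which equals N(C). *)
    have CW : C \o_b W = 0.
      apply/bopP => l; change (null_space C (W l)).
      by rewrite NC; apply: Wker; exists l.
    have /(_ 0 T1) := block_op_factorization D _ _ _ CW.
    rewrite add0r; apply.
    + exact/bopP.
    + exact/bopP.
    + by apply/bopP => x; rewrite !bopE bop0.
    + by rewrite add0r.
  (* The pairs are an image of the admissible set, so its countability would pass to them. *)
  apply: contra_not uncountable_pairs => cA.
  by apply: sub_countable cA; exact: card_image_le.
- move=> T1_idem E1 E2 admissible; split.
    move=> W C [Wker WT1C CT2]; rewrite T_rep.1.
    apply: block_op_factorization => //; apply/bopP => x; rewrite !bopE.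
    + by apply: Wker; exists x.
    + by apply: WT1C; right; exists x.
    + by apply: WT1C; left; exists x.
    (* Since R(C) lies in N(T2), the required T1 = S + T2 C holds with S = T1. *)
    + have -> : T2 (C x) = 0 by apply: CT2; exists x.
      by rewrite addr0.
  (* C = 0 meets every condition on [C], so varying [V] alone gives uncountably many pairs. *)
  apply: (@uncountable_family R _ _ (fun t => (E1 (V t), E2 (V t) 0))).
    by move=> s t /(congr1 snd) /= /block_op_inj2/V_inj.
  move=> t; exists (V t, 0) => //; split=> /=; first exact: V_ker.
    by move=> x _; exact: bop_0E.
  by move=> _ [x _ <-]; exact: bop0.
Qed.
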